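(* Let $N\ge2$, let $\mu_1<\cdots<\mu_K<0$ be the distinct spectral values with multiplicities $k_1,\dots,k_K\ge1$, $k_1+\cdots+k_K=N$, let $\eta_\alpha=\sqrt{|\mu_\alpha|}$, and let $u=(u_1,\dots,u_N)\in\mathcal{M}_{\mathrm{multi}}$ be written as $$u_i=n_i^{(\alpha)}V_\alpha^a,\qquad i\in I_\alpha,\ \alpha=1,\dots,K,$$ with $a\in(\mathbb{R}\setminus\{0\})^K$ and $n^{(\alpha)}\in\mathbb{S}^{k_\alpha-1}$ (notation as defined in the context). Then $$\int_{\mathbb{R}}u_i^2\,dx=\big(n_i^{(\alpha)}\big)^2\int_{\mathbb{R}}(V_\alpha^a)^2\,dx=2\eta_\alpha\big(n_i^{(\alpha)}\big)^2,\qquad i\in I_\alpha,\ \alpha=1,\dots,K.$$ Hence $u$ satisfies $\int_{\mathbb{R}}u_i^2\,dx=1$ for all $i=1,\dots,N$ if and only if $$\eta_\alpha=\sqrt{|\mu_\alpha|}=\frac{k_\alpha}{2}\quad\text{and}\quad\big(n_i^{(\alpha)}\big)^2=\frac1{k_\alpha},\qquad i\in I_\alpha,\ \alpha=1,\dots,K.$$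
   Context: All functions are real-valued. Blocks: $N_0:=0$, $N_\alpha:=k_1+\cdots+k_\alpha$, $I_\alpha:=\{N_{\alpha-1}+1,\dots,N_\alpha\}$ for $\alpha=1,\dots,K$. Reduced determinant family: for $a=(a_1,\dots,a_K)\in(\mathbb{R}\setminus\{0\})^K$ let $V^a=(V_1^a,\dots,V_K^a)$ with $$V_\alpha^a(x)=\frac{a_\alpha e^{\eta_\alpha x}\det(I+B^{(\alpha)}M(x))}{\det(I+M(x))},$$ where $I$ is the $K\times K$ identity matrix, $M(x)=(m_{\beta\gamma}(x))_{1\le\beta,\gamma\le K}$ with $m_{\beta\gamma}(x)=\frac{a_\beta a_\gamma}{2\sqrt{\eta_\beta\eta_\gamma}(\eta_\beta+\eta_\gamma)}e^{(\eta_\beta+\eta_\gamma)x}$, and $B^{(\alpha)}=\operatorname{diag}\big(\frac{\eta_\alpha-\eta_1}{\eta_\alpha+\eta_1},\dots,\frac{\eta_\alpha-\eta_K}{\eta_\alpha+\eta_K}\big)$. Extended family: for $a\in(\mathbb{R}\setminus\{0\})^K$ and unit vectors $n^{(\alpha)}=(n^{(\alpha)}_i)_{i\in I_\alpha}\in\mathbb{S}^{k_\alpha-1}\subset\mathbb{R}^{k_\alpha}$, $\alpha=1,\dots,K$, define $U^{a,n}$ by $U_i^{a,n}(x)=n_i^{(\alpha)}V_\alpha^a(x)$ for $i\in I_\alpha$, $\alpha=1,\dots,K$; $\mathcal{M}_{\mathrm{multi}}$ is the set of all such $U^{a,n}$. With $\nu_i:=\mu_\alpha$ for $i\in I_\alpha$,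 its elements are solutions of $u_i''+2(\sum_{j=1}^Nu_j^2)u_i+\nu_iu_i=0$ in $\mathbb{R}$, $i=1,\dots,N$. *)

(* Defs.v *)
From HB Require Import structures.
From mathcomp Require Import all_boot all_order all_algebra.
From mathcomp Require Import all_classical all_reals all_analysis.

Set Implicit Arguments.
Unset Strict Implicit.
Unset Printing Implicit Defensive.

Import Order.TTheory GRing.Theory Num.Theory.
Local Open Scope ring_scope.

(* Spectral indices alpha = 1, ..., K and component indices i = 1, ..., N are
   numbered from 0, as elements of 'I_K and 'I_N. *)

(* N_(alpha-1): the total multiplicity of the blocks preceding alpha. *)
Definition block_start (K : nat) (k : 'I_K -> nat) (alpha : 'I_K) : nat :=
  (\sum_(beta < K | beta < alpha) k beta)%N.

(* I_alpha = {N_(alpha-1) + 1, ..., N_alpha}, shifted down by one. *)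
Definition block (N K : nat) (k : 'I_K -> nat) (alpha : 'I_K) : {set 'I_N} :=
  [set i : 'I_N | (block_start k alpha <= i < block_start k alpha + k alpha)%N]%SET.

Definition eta_of (R : realType) (K : nat) (mu : 'I_K -> R) (alpha : 'I_K) : R :=
  Num.sqrt `|mu alpha|.

Definition Mmat (R : realType) (K : nat) (eta a : 'I_K -> R) (x : R) : 'M[R]_K :=
  \matrix_(beta < K, gamma < K)
    (a beta * a gamma
       / (2 * Num.sqrt (eta beta * eta gamma) * (eta beta + eta gamma))
     * expR ((eta beta + eta gamma) * x)).

Definition Bmat (R : realType) (K : nat) (eta : 'I_K -> R) (alpha : 'I_K) :
    'M[R]_K :=
  diag_mx (\row_(beta < K)
    ((eta alpha - eta beta) / (eta alpha + eta beta))).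

Definition V_red (R : realType) (K : nat) (eta a : 'I_K -> R) (alpha : 'I_K)
    (x : R) : R :=
  a alpha * expR (eta alpha * x)
    * \det (1%:M + Bmat eta alpha *m Mmat eta a x)
  / \det (1%:M + Mmat eta a x).

(* A family of unit vectors n^(alpha) = (n^(alpha)_i)_(i in I_alpha) is encoded
   by n : 'I_K -> 'I_N -> R; only the values n alpha i with i in I_alpha are
   ever used. *)
Definition unit_blocks (R : realType) (N K : nat) (k : 'I_K -> nat)
    (n : 'I_K -> 'I_N -> R) : Prop :=
  forall alpha : 'I_K, \sum_(i in block N k alpha) n alpha i ^+ 2 = 1.

(* u = U^(a,n).  The blocks partition 'I_N when the multiplicities k sum to N,
   so u is then determined by a and n. *)
Definition is_U (R : realType) (N K : nat) (mu : 'I_K -> R) (k : 'I_K -> nat)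
    (a : 'I_K -> R) (n : 'I_K -> 'I_N -> R) (u : 'I_N -> R -> R) : Prop :=
  forall (alpha : 'I_K) (i : 'I_N), i \in block N k alpha ->
    forall x : R, u i x = n alpha i * V_red (eta_of mu) a alpha x.

Definition M_multi (R : realType) (N K : nat) (mu : 'I_K -> R)
    (k : 'I_K -> nat) : set ('I_N -> R -> R) :=
  [set u | exists (a : 'I_K -> R) (n : 'I_K -> 'I_N -> R),
     [/\ forall alpha, a alpha != 0, unit_blocks k n & is_U mu k a n u]]%classic.

(* Main.v *)
Require Import Defs.
From HB Require Import structures.
From mathcomp Require Import all_boot all_order all_algebra.
From mathcomp Require Import ring lra.
From mathcomp Require Import all_classical all_reals all_analysis.
From mathcomp Require Import measurable_realfun.

Set Implicit Arguments.
Unset Strict Implicit.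
Unset Printing Implicit Defensive.

Import Order.TTheory GRing.Theory Num.Theory.
Import numFieldNormedType.Exports.
Local Open Scope ring_scope.

(* Put f_i = a_i e^(eta_i x) / sqrt(2 eta_i).  Then M = (f_i f_j / (eta_i + eta_j))
   is positive semidefinite, and with W = (1 + M)^-1 and w = W f Cramer's rule
   gives V_alpha = sqrt(2 eta_alpha) w_alpha.  As M' = f f^T, W' = - w w^T, so the
   integral of w_alpha^2 is the drop of W_(alpha,alpha) between -oo, where M
   tends to 0, and +oo, where M blows up; this drop is 1. *)

(** * Determinants of rank one perturbations and of diagonal conjugates *)

Lemma det_sub_rank1 (F : comUnitRingType) (K : nat) (c : 'cV[F]_K) (r : 'rV[F]_K) :
  \det (1%:M - c *m r) = 1 - (r *m c) 0 0.
Proof.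
(* The same bordered matrix is factored with either diagonal block as pivot; comparing determinants
   equates those of the two Schur complements. *)
have e1 : block_mx 1%:M c r (1%:M : 'M[F]_1) =
    block_mx 1%:M 0 r 1%:M *m block_mx 1%:M c 0 (1%:M - r *m c).
  by rewrite mulmx_block !mulmx1 !mul1mx !mul0mx ?mulmx0 !addr0 addrC subrK.
have e2 : block_mx 1%:M c r (1%:M : 'M[F]_1) =
    block_mx (1%:M - c *m r) c 0 1%:M *m block_mx 1%:M 0 r 1%:M.
  by rewrite mulmx_block !mulmx1 !mul1mx !mul0mx ?mulmx0 !add0r subrK.
have := congr1 determinant e1.
rewrite e2 !det_mulmx !det_ublock !det_lblock !det1 !mulr1 !mul1r => ->.
by rewrite det_mx11 !mxE.
Qed.

(** Similarity by [diag_mx d], put entrywise so that it reduces to a field identity. *)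
Lemma det_conj_diag (F : fieldType) (K : nat) (d : 'rV[F]_K) (A A' : 'M[F]_K) :
  (forall i, d 0 i != 0) ->
  (forall i j, d 0 i * A i j = A' i j * d 0 j) -> \det A = \det A'.
Proof.
move=> d0 AA'; have : diag_mx d *m A = A' *m diag_mx d.
  apply/matrixP => i j.
  by rewrite mul_diag_mx mul_mx_diag !mxE AA'.
move/(congr1 determinant); rewrite !det_mulmx mulrC => /mulIf; apply.
by rewrite det_diag; apply/prodf_neq0 => i _.
Qed.

(** * Positivity of Cauchy matrices and the inverse of 1 + M *)

Section Cauchy.
Variables (R : realType) (K : nat) (eta : 'I_K -> R).
Hypothesis eta_gt0 : forall i, 0 < eta i.
Hypothesis eta_inj : injective eta.

(** This is the squared norm in L^2(0, +oo) of the sum of the v_i e^(-eta_i t); positivity is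
    obtained below by elimination instead. *)
Definition cauchy_form (v : 'I_K -> R) : R :=
  \sum_i \sum_j v i * v j / (eta i + eta j).

Let eta_neq0 i j : eta i + eta j != 0.
Proof. by rewrite gt_eqF// addr_gt0. Qed.

(* Elimination of the pivot p: the Schur complement of a Cauchy matrix is again
   a Cauchy matrix, up to a diagonal congruence. *)
Lemma cauchy_form_schur p (v : 'I_K -> R) :
  cauchy_form v =
    2 * eta p * (\sum_i v i / (eta i + eta p)) ^+ 2
    + cauchy_form (fun i => v i * ((eta i - eta p) / (eta i + eta p))).
Proof.
rewrite /cauchy_form expr2 big_distrlr/= mulr_sumr -big_split/=.
apply: eq_bigr => i _; rewrite mulr_sumr -big_split/=.
apply: eq_bigr => j _.
have := eta_neq0 i j; have := eta_neq0 i p; have := eta_neq0 j p.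
by move=> ? ? ?; field; do ?[apply/andP; split].
Qed.

(** Induction on the number of nonzero coefficients: pivoting at p kills the coefficient at p and
    creates no new one. *)
Lemma cauchy_form_gt0 (v : 'I_K -> R) p : v p != 0 -> 0 < cauchy_form v.
Proof.
have [m] := ubnP #|[set i | v i != 0]%SET|.
elim: m => // m IH in v p *; rewrite ltnS => vm vp.
rewrite (cauchy_form_schur p).
set v' := fun i => v i * _.
have v'p : v' p = 0 by rewrite /v' subrr mul0r mulr0.
have pge0 : 0 <= 2 * eta p * (\sum_i v i / (eta i + eta p)) ^+ 2.
  by rewrite mulr_ge0 ?sqr_ge0// mulr_ge0// ltW.
have v'm : (#|[set i | v' i != 0%R]%SET| < m)%N.
  apply: leq_trans vm; apply: proper_card; apply/properP; split.
    apply/fintype.subsetP => i; rewrite !inE /v'.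
    by apply: contra => /eqP ->; rewrite mul0r.
  by exists p; rewrite !inE ?vp// v'p eqxx.
(* If nothing survives the elimination, distinctness of the eta forces v to be supported at p, and
   then the square is positive. *)
have [[q v'q]|v'0] := pselect (exists q, v' q != 0).
  exact: ltr_wpDl pge0 (IH _ _ v'm v'q).
have v'00 i : v' i = 0.
  by apply: contrapT => /eqP v'i; apply: v'0; exists i.
have vi i : i != p -> v i = 0.
  move=> ip; have /eqP := v'00 i.
  rewrite /v' !mulf_eq0 invr_eq0 (negbTE (eta_neq0 _ _)) orbF subr_eq0.
  by rewrite (inj_eq eta_inj) (negbTE ip) orbF => /eqP.
have -> : cauchy_form v' = 0.
  by rewrite /cauchy_form big1// => i _; rewrite big1// => j _;
     rewrite v'00 !mul0r.
rewrite addr0 (bigD1 p)//= big1 ?addr0; last first.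
  by move=> i ip; rewrite vi// mul0r.
have pp : v p / (eta p + eta p) != 0 by rewrite mulf_neq0// invr_neq0.
by apply: mulr_gt0; rewrite ?exprn_even_gt0//; exact: mulr_gt0.
Qed.

Lemma cauchy_form_ge0 (v : 'I_K -> R) : 0 <= cauchy_form v.
Proof.
have [[q vq]|v0] := pselect (exists q, v q != 0).
  exact/ltW/(cauchy_form_gt0 vq).
rewrite /cauchy_form big1// => i _; rewrite big1// => j _.
suff -> : v i = 0 by rewrite !mul0r.
by apply: contrapT => /eqP vi; apply: v0; exists i.
Qed.

Definition cauchy_mx : 'M[R]_K := \matrix_(i, j) (eta i + eta j)^-1.

(** A row in the left kernel annihilates the form, hence is zero by definiteness. The limit of W at
    +oo rests on this. *)
Lemma cauchy_mx_unit : cauchy_mx \in unitmx.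
Proof.
rewrite -row_free_unit; apply: inj_row_free => y yC.
have : cauchy_form (y 0) = 0.
  transitivity ((y *m cauchy_mx *m y^T) 0 0); last by rewrite yC mul0mx mxE.
  rewrite /cauchy_form !mxE exchange_big/=; apply: eq_bigr => j _.
  rewrite !mxE mulr_suml; apply: eq_bigr => i _.
  by rewrite !mxE mulrAC.
move=> y0; apply/rowP => i; rewrite mxE; apply: contrapT => /eqP yi.
by have := cauchy_form_gt0 yi; rewrite y0 ltxx.
Qed.

Variable f : 'I_K -> R.

(** M for arbitrary amplitudes f; below, [tau_inv] is W and [tau_vec] is w. *)
Definition tau_mx : 'M[R]_K := \matrix_(i, j) (f i * f j / (eta i + eta j)).
Definition tau_inv : 'M[R]_K := invmx (1%:M + tau_mx).

(** Source of both the invertibility of 1 + M and the bound on the entries of W. *)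
Lemma quad_tau (y : 'rV[R]_K) :
  (y *m (1%:M + tau_mx) *m y^T) 0 0 =
  \sum_i y 0 i ^+ 2 + cauchy_form (fun i => y 0 i * f i).
Proof.
rewrite mulmxDr mulmx1 mulmxDl mxE; congr (_ + _).
  by rewrite mxE; apply: eq_bigr => i _; rewrite mxE.
rewrite /cauchy_form !mxE exchange_big/=; apply: eq_bigr => j _.
rewrite !mxE mulr_suml; apply: eq_bigr => i _.
by rewrite !mxE; ring.
Qed.

Lemma tau_unit : 1%:M + tau_mx \in unitmx.
Proof.
rewrite -row_free_unit; apply: inj_row_free => y yC.
have := quad_tau y; rewrite yC mul0mx mxE => /esym/eqP.
rewrite paddr_eq0 ?cauchy_form_ge0// ?sumr_ge0// => [/andP[+ _]|i _]; last first.
  exact: sqr_ge0.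
rewrite psumr_eq0 => [/allP y0|i _]; last exact: sqr_ge0.
apply/rowP => i; rewrite mxE.
by have := y0 i (mem_index_enum _); rewrite /= sqrf_eq0 => /eqP.
Qed.

Lemma tau_inv_tr : tau_inv^T = tau_inv.
Proof.
rewrite /tau_inv trmx_inv linearD/= trmx1; congr (invmx (_ + _)).
by apply/matrixP => i j; rewrite !mxE [f j * _]mulrC [eta j + _]addrC.
Qed.

Lemma tau_inv_sym i j : tau_inv i j = tau_inv j i.
Proof. by rewrite -[in LHS]tau_inv_tr mxE. Qed.

(* The row y = e_i (1 + M)^-1 satisfies |y|^2 + y M y^T = y_i with M positive. *)
Lemma tau_inv_le1 i j : `|tau_inv i j| <= 1.
Proof.
pose y := row i tau_inv.
have yT : y *m (1%:M + tau_mx) = delta_mx 0 i.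
  by rewrite -row_mul mulVmx ?tau_unit// row1.
have := quad_tau y; rewrite yT -rowE !mxE => yi.
have yle k : (y 0 k) ^+ 2 <= y 0 i.
  rewrite [leRHS]mxE yi (bigD1 k)//= -addrA lerDl addr_ge0 ?cauchy_form_ge0//.
  by rewrite sumr_ge0// => l _; exact: sqr_ge0.
(* At k = i, [yle] reads y_i^2 <= y_i, so y_i <= 1; then y_j^2 <= y_i <= 1. *)
have yi1 : y 0 i <= 1.
  have := yle i; rewrite -subr_ge0 => h; rewrite leNgt; apply/negP => y1.
  by move: h; nra.
have := le_trans (yle j) yi1; rewrite -[leLHS]real_normK ?num_real//.
by rewrite expr_le1// [y 0 j]mxE.
Qed.

Lemma tau_inv_mul : (1%:M + tau_mx) *m tau_inv = 1%:M.
Proof. by rewrite mulmxV ?tau_unit. Qed.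

Definition tau_vec (i : 'I_K) : R := \sum_j tau_inv i j * f j.

Lemma tau_vecE i : tau_vec i + \sum_j f i * f j / (eta i + eta j) * tau_vec j = f i.
Proof.
pose fc := \col_j f j.
have vE j : tau_vec j = (tau_inv *m fc) j 0.
  by rewrite mxE; apply: eq_bigr => l _; rewrite mxE.
have := congr1 (fun A => (A *m fc) i 0) tau_inv_mul.
rewrite mul1mx -mulmxA mulmxDl mul1mx mxE -vE [RHS]mxE => h.
rewrite -[RHS]h; congr (_ + _).
by rewrite mxE; apply: eq_bigr => j _; rewrite vE [tau_mx _ _]mxE.
Qed.

(* Conjugating 1 + B M by diag(eta p + eta i) turns it into a rank one
   perturbation of 1 + M. *)
Lemma tau_vec_det p :
  f p * \det (1%:M + Bmat eta p *m tau_mx) = \det (1%:M + tau_mx) * tau_vec p.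
Proof.
pose r : 'rV[R]_K := \row_j (f j / (eta p + eta j)).
pose w : 'cV[R]_K := \col_j tau_vec j.
have wE : (1%:M + tau_mx) *m w = \col_j f j.
  apply/colP => i; rewrite mulmxDl mul1mx !mxE -[RHS]tau_vecE; congr (_ + _).
  by apply: eq_bigr => j _; rewrite !mxE.
(* As (1 + M) w = f, the product is 1 + M - f r; its (i, j) entry is that of 1 + B M times (eta p +
   eta i) / (eta p + eta j). *)
have -> : \det (1%:M + Bmat eta p *m tau_mx) =
    \det ((1%:M + tau_mx) *m (1%:M - w *m r)).
  apply: (@det_conj_diag _ _ (\row_j (eta p + eta j))) => [i|i j].
    by rewrite mxE.
  rewrite mulmxBr mulmx1 mulmxA wE /Bmat mul_diag_mx !mxE big_ord1 !mxE.
  have := eta_neq0 i j; have := eta_neq0 p i; have := eta_neq0 p j.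
  have [->|_] := eqVneq i j => ? ? ?; rewrite ?mulr1n ?mulr0n;
    by field; do ?[apply/andP; split].
(* Row p of (1 + M) w = f says f_p (1 - r w) = w_p. *)
rewrite det_mulmx det_sub_rank1 mulrCA; congr (_ * _).
rewrite mulrBr mulr1 -[in X in X - _]tau_vecE -[RHS]addr0 -addrA; congr (_ + _).
apply/eqP; rewrite subr_eq0; apply/eqP; rewrite mxE mulr_sumr.
by apply: eq_bigr => j _; rewrite !mxE; ring.
Qed.

End Cauchy.

(** * Limits, and the fundamental theorem of calculus on the whole line *)

Local Open Scope classical_set_scope.

Lemma cvg_sumr (R : realType) (T I : Type) (F : set_system T) (r : seq I)
    (h : I -> T -> R) (l : I -> R) : Filter F ->
  (forall i, h i t @[t --> F] --> l i) ->
  \sum_(i <- r) h i t @[t --> F] --> \sum_(i <- r) l i.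
Proof. by move=> FF hl; apply: cvg_big => //; exact: add_continuous. Qed.

Lemma cvg_sumr0 (R : realType) (T I : Type) (F : set_system T) (r : seq I)
    (h : I -> T -> R) : Filter F ->
  (forall i, h i t @[t --> F] --> 0) -> \sum_(i <- r) h i t @[t --> F] --> 0.
Proof.
by move=> FF h0; have := @cvg_sumr _ _ _ _ r _ _ FF h0; rewrite big1_eq.
Qed.

Lemma cvgM0 (R : realType) (T : Type) (F : set_system T) (c : R)
    (h : T -> R) : Filter F ->
  h t @[t --> F] --> 0 -> c * h t @[t --> F] --> 0.
Proof. by move=> FF h0; have := cvgM (cvg_cst c) h0; rewrite mulr0; apply. Qed.

Lemma norm_le_cvg0 (R : realType) (T : Type) (F : set_system T)
    (g h : T -> R) : Filter F ->
  (forall t, `|h t| <= g t) -> g t @[t --> F] --> 0 -> h t @[t --> F] --> 0.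
Proof.
move=> FF hg g0; apply: norm_cvg0; apply: (squeeze_cvgr _ (cvg_cst 0) g0).
by apply: nearW => t; rewrite normr_ge0 hg.
Qed.

Lemma cvgNy_expR (R : realType) (c : R) : 0 < c ->
  expR (c * x) @[x --> -oo] --> 0.
Proof.
move=> c0; apply: (@cvg_comp _ _ _ _ _ _ (@ninfty_nbhs R)).
  by apply: gt0_cvgMrNy c0 _; exact: cvg_id.
exact/cvgNy_compNP/cvgr_expR.
Qed.

Lemma cvgy_expRN (R : realType) (c : R) : 0 < c ->
  expR (- (c * x)) @[x --> +oo] --> 0.
Proof.
move=> c0; apply/cvgy_compNP; have := cvgNy_expR c0.
by apply: cvg_trans; apply: near_eq_cvg; apply: nearW => x /=; rewrite mulrN opprK.
Qed.

(** The line is cut at 0, and x -> -x carries the left half to the right one, with primitive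
    [- F (- y)]. *)
Lemma ge0_continuous_FTC2T (R : realType) (f F : R -> R) (lm lp : R) :
  (forall x, 0 <= f x) -> continuous f ->
  (forall x : R, is_derive x 1 F (f x)) ->
  F x @[x --> -oo] --> lm -> F x @[x --> +oo] --> lp ->
  (\int[lebesgue_measure]_x (f x)%:E = (lp - lm)%:E)%E.
Proof.
move=> f0 cf dF Fm Fp.
have cF : continuous F.
  by move=> x; apply/differentiable_continuous/derivable1_diffP; case: (dF x).
have mf : measurable_fun [set: R] f by exact: continuous_measurable_fun.
have posE : (\int[lebesgue_measure]_(x in `[0%R, +oo[) (f x)%:E =
    lp%:E - (F 0)%:E)%E.
  apply: ge0_continuous_FTC2y => //.
  - exact: continuous_subspaceT.
  - by apply: cvg_at_right_filter; exact: cF.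
  - by move=> x _; rewrite derive1E; case: (dF x).
have dG (x : R) : is_derive x 1 (fun y => - F (- y)) (f (- x)).
  have dN : is_derive x 1 (-%R : R -> R) (-1 : R) by exact: is_deriveN.
  have := is_deriveN (is_derive1_comp (dF (- x)) dN).
  by rewrite mulrN1 opprK.
have negE : (\int[lebesgue_measure]_(x in `]-oo, 0%R]) (f x)%:E =
    (F 0)%:E - lm%:E)%E.
  rewrite -[X in `]-oo, X]]oppr0 ge0_integration_by_substitutionNy//; last first.
    exact: continuous_subspaceT.
  have cfN : continuous (f \o -%R).
    by move=> x; apply: continuous_comp; [exact: opp_continuous|exact: cf].
  rewrite (@ge0_continuous_FTC2y _ _ (fun y => - F (- y)) _ (- lm)).
  - by rewrite oppr0 -EFinB -EFinB opprK addrC.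
  - by move=> x _; exact: f0.
  - exact: continuous_subspaceT.
  - by apply: cvgN; exact/cvgNy_compNP.
  - by move=> x _; case: (dG x).
  - apply: cvg_at_right_filter; apply: cvgN.
    by apply: continuous_comp; [exact: opp_continuous|exact: cF].
  - by move=> x _; rewrite derive1E; case: (dG x).
(* The line is the complement of the empty interval ]0, 0], that is, ]-oo, 0] together with ]0,
   +oo[. *)
rewrite -{1}setC0 -(set_itvoc0 0%R) setCitv/= ge0_integral_setU//=; first last.
- rewrite disj_set2E; apply/eqP; rewrite -subset0 => x []/= /[!in_itv]/=.
  by rewrite leNgt andbT => /negP.
- by move=> x _; rewrite lee_fin.
- exact/measurable_EFinP/measurable_funTS.
rewrite integral_itv_obnd_cbnd; last exact/measurable_EFinP/measurable_funTS.
by rewrite negE posE -!EFinB -EFinD; congr EFin; ring.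
Qed.

(** * Dependence of W on x, and the integral of V^2 *)

Section Solitons.
Variables (R : realType) (K : nat) (eta a : 'I_K -> R).
Hypothesis eta_gt0 : forall i, 0 < eta i.
Hypothesis eta_inj : injective eta.
Hypothesis a_neq0 : forall i, a i != 0.

Definition amp (x : R) (i : 'I_K) : R :=
  a i * expR (eta i * x) / Num.sqrt (2 * eta i).

Let sqrt_neq0 i : Num.sqrt (2 * eta i) != 0.
Proof. by rewrite gt_eqF// sqrtr_gt0 mulr_gt0. Qed.

(** The factor 2 sqrt(eta_i eta_j) is sqrt(2 eta_i) sqrt(2 eta_j), absorbed by the normalisation of
    [amp]. *)
Lemma Mmat_tau x : Mmat eta a x = tau_mx eta (amp x).
Proof.
apply/matrixP => i j; rewrite !mxE /amp [(_ + _) * x]mulrDl expRD.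
have e0 k : 0 <= 2 * eta k by rewrite mulr_ge0// ltW.
have -> : 2 * Num.sqrt (eta i * eta j) =
    Num.sqrt (2 * eta i) * Num.sqrt (2 * eta j).
  by rewrite -[RHS]sqrtrM// mulrACA [RHS]sqrtrM// -expr2 sqrtr_sqr ger0_norm.
have := sqrt_neq0 i; have := sqrt_neq0 j.
have : eta i + eta j != 0 by rewrite gt_eqF// addr_gt0.
by move=> ? ? ?; field; do ?[apply/andP; split].
Qed.

Local Notation W := (fun x => tau_inv eta (amp x)).

Lemma V_redE p x :
  V_red eta a p x = Num.sqrt (2 * eta p) * tau_vec eta (amp x) p.
Proof.
have d0 : \det (1%:M + tau_mx eta (amp x)) != 0.
  by rewrite -unitfE -unitmxE tau_unit.
rewrite /V_red Mmat_tau.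
have -> : a p * expR (eta p * x) = Num.sqrt (2 * eta p) * amp x p.
  by rewrite /amp mulrCA divff// mulr1.
by rewrite -[_ * amp x p * _]mulrA tau_vec_det// [\det _ * _]mulrC mulrA mulfK.
Qed.

(** Resolvent identity W(z) - W(x) = W(z) (M(x) - M(z)) W(x); continuity and derivative of W both
    follow from it. *)
Lemma tau_inv_resolvent x z i j : W z i j - W x i j =
  \sum_k (\sum_l W z i l * (tau_mx eta (amp x) l k - tau_mx eta (amp z) l k))
    * W x k j.
Proof.
have : W z - W x = W z *m (tau_mx eta (amp x) - tau_mx eta (amp z)) *m W x.
  rewrite -[tau_mx _ (amp x)](addKr 1%:M) -[tau_mx _ (amp z)](addKr 1%:M).
  rewrite opprD addrACA subrr add0r mulmxBr mulmxBl.
  rewrite -mulmxA tau_inv_mul// mulmx1; congr (_ - _).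
  by rewrite mulVmx ?tau_unit// mul1mx.
move=> /(congr1 (fun A : 'M[R]_K => A i j)); rewrite !mxE => ->.
apply: eq_bigr => k _; rewrite !mxE; congr (_ * _).
by apply: eq_bigr => l _; rewrite !mxE.
Qed.

Lemma is_derive_amp (x : R) i : is_derive x 1 (fun y => amp y i) (eta i * amp x i).
Proof.
rewrite /amp; apply: is_derive_eq.
by rewrite /GRing.scale/=; ring.
Qed.

(** The product rule yields a factor eta i + eta j, which cancels the Cauchy denominator. *)
Lemma is_derive_tau (x : R) i j :
  is_derive x 1 (fun y => tau_mx eta (amp y) i j) (amp x i * amp x j).
Proof.
have di := is_derive_amp x i; have dj := is_derive_amp x j.
have -> : (fun y => tau_mx eta (amp y) i j) =
    (fun y => (eta i + eta j)^-1 * (amp y i * amp y j)).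
  by apply/funext => y; rewrite mxE mulrC.
have e0 : eta i + eta j != 0 by rewrite gt_eqF// addr_gt0.
apply: is_derive_eq; rewrite /GRing.scale/=.
by field.
Qed.

Lemma continuous_amp i : continuous (fun x => amp x i).
Proof.
by move=> x; apply/differentiable_continuous/derivable1_diffP;
  case: (is_derive_amp x i).
Qed.

Lemma continuous_tau i j : continuous (fun x => tau_mx eta (amp x) i j).
Proof.
by move=> x; apply/differentiable_continuous/derivable1_diffP;
  case: (is_derive_tau x i j).
Qed.

(** Entries of W are bounded by 1 uniformly in z, so the resolvent identity bounds W(z) - W(x) by
    differences of entries of M. *)
Lemma continuous_tau_inv i j : continuous (fun x => W x i j).
Proof.
move=> x; apply/subr_cvg0; under eq_fun do rewrite tau_inv_resolvent.
apply: cvg_sumr0 => k.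
apply: (@norm_le_cvg0 _ _ _
  (fun z => \sum_l `|tau_mx eta (amp z) l k - tau_mx eta (amp x) l k|)) => [z|].
  rewrite normrM; apply: le_trans (ler_piMr _ (tau_inv_le1 _ _ _ _ _)) _ => //.
  apply: le_trans (ler_norm_sum _ _ _) _; apply: ler_sum => l _.
  by rewrite normrM distrC ler_piMl// tau_inv_le1.
apply: cvg_sumr0 => l; apply/norm_cvg0P/subr_cvg0; exact: continuous_tau.
Qed.

Lemma continuous_tau_vec i : continuous (fun x => tau_vec eta (amp x) i).
Proof.
move=> x; apply: cvg_sumr => j.
by apply: cvgM; [exact: continuous_tau_inv|exact: continuous_amp].
Qed.

(* W' = - W M' W, and M' is the rank one matrix of the products of amplitudes. *)
Lemma is_derive_tau_inv (x : R) p :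
  is_derive x 1 (fun y => - W y p p) (tau_vec eta (amp x) p ^+ 2).
Proof.
have /choice[g gP] (lk : 'I_K * 'I_K) := (is_derive1_caratheodory _ _ _).1
  (is_derive_tau x lk.1 lk.2).
apply/is_derive1_caratheodory.
(* Slope of -W from the resolvent identity, each difference in M being replaced by its slope [g]. At
   z = x it factors as w_p^2, by symmetry of W. *)
exists (fun z => \sum_k (\sum_l W z p l * g (l, k) z) * W x k p); split.
- move=> z; rewrite -opprD tau_inv_resolvent -sumrN mulr_suml.
  apply: eq_bigr => k _; rewrite -mulNr mulrAC; congr (_ * _).
  rewrite -sumrN mulr_suml; apply: eq_bigr => l _.
  by have [/= gz _ _] := gP (l, k); rewrite -mulrN opprB gz mulrA.
- apply: cvg_sumr => k; apply: cvgM; last exact: cvg_cst.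
  apply: cvg_sumr => l; apply: cvgM; first exact: continuous_tau_inv.
  by have [_ + _] := gP (l, k).
- rewrite expr2 {2}/tau_vec mulr_sumr; apply: eq_bigr => k _.
  rewrite [W x k p]tau_inv_sym mulrCA [RHS]mulrC; congr (_ * _).
  rewrite /tau_vec mulr_suml; apply: eq_bigr => l _.
  by have [_ _ ->] := gP (l, k); rewrite mulrA.
Qed.


Lemma cvgNy_tau i j : tau_mx eta (amp x) i j @[x --> -oo] --> 0.
Proof.
have amp0 k : amp x k @[x --> -oo] --> 0.
  have -> : amp^~ k =
      (fun x => a k / Num.sqrt (2 * eta k) * expR (eta k * x)).
    by apply/funext => x; rewrite /amp mulrAC.
  by apply: cvgM0; exact: cvgNy_expR.
have -> : (fun x => tau_mx eta (amp x) i j) =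
    (fun x => (eta i + eta j)^-1 * (amp x i * amp x j)).
  by apply/funext => x; rewrite mxE mulrC.
by apply: cvgM0; have := cvgM (amp0 i) (amp0 j); rewrite mulr0; apply.
Qed.

Lemma cvgy_ampV i : (amp x i)^-1 @[x --> +oo] --> 0.
Proof.
have -> : (fun x => (amp x i)^-1) =
    (fun x => Num.sqrt (2 * eta i) / a i * expR (- (eta i * x))).
  apply/funext => x; rewrite /amp expRN !invfM invrK.
  by rewrite mulrC mulrA.
by apply: cvgM0; exact: cvgy_expRN.
Qed.

Lemma tau_inv_col x i p :
  W x i p + \sum_j tau_mx eta (amp x) i j * W x j p = (i == p)%:R.
Proof.
have := congr1 (fun A : 'M[R]_K => A i p)
  (tau_inv_mul eta_gt0 eta_inj (amp x)).
by rewrite mulmxDl mul1mx !mxE.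
Qed.

(** W_pp - 1 = - (M W)_pp, where W is bounded and M tends to 0. *)
Lemma cvgNy_tau_inv p : W x p p @[x --> -oo] --> (1 : R).
Proof.
apply/subr_cvg0.
apply: (@norm_le_cvg0 _ _ _
  (fun x => \sum_j `|tau_mx eta (amp x) p j|)) => [x|].
  have := tau_inv_col x p p; rewrite eqxx mulr1n => <-.
  rewrite opprD addNKr normrN.
  apply: le_trans (ler_norm_sum _ _ _) _; apply: ler_sum => j _.
  by rewrite normrM ler_piMr// tau_inv_le1.
by apply: cvg_sumr0 => j; apply/norm_cvg0P; exact: cvgNy_tau.
Qed.

(* At +oo the matrix M blows up like D C D, with D = diag(amp) and C the
   invertible Cauchy matrix. *)
Lemma cvgy_tau_inv p : W x p p @[x --> +oo] --> 0.
Proof.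
pose z i := invmx (cauchy_mx eta) p i.
have zC j : \sum_i z i / (eta i + eta j) = (p == j)%:R.
  have := congr1 (fun A : 'M[R]_K => A p j)
    (mulVmx (cauchy_mx_unit eta_gt0 eta_inj)).
  by rewrite !mxE => <-; apply: eq_bigr => i _; rewrite [cauchy_mx _ _ _]mxE.
have amp_neq0 x i : amp x i != 0.
  by rewrite /amp !mulf_neq0// ?invr_neq0// gt_eqF// expR_gt0.
(* Since M W = 1 - W and M_ij = f_i f_j C_ij, applying row p of C^-1 isolates f_p W_pp. What remains
   is bounded terms over products of growing amplitudes. *)
have WE x : W x p p =
    \sum_i z i * ((i == p)%:R - W x i p) * ((amp x i)^-1 * (amp x p)^-1).
  apply: (mulIf (amp_neq0 x p)); rewrite mulr_suml.
  transitivity (\sum_i \sum_j z i / (eta i + eta j) * (amp x j * W x j p)).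
    rewrite exchange_big/=; under eq_bigr do rewrite -mulr_suml zC.
    rewrite (bigD1 p)//= eqxx mul1r mulrC big1 ?addr0// => j.
    by rewrite eq_sym => /negbTE ->; rewrite mul0r.
  apply: eq_bigr => i _; rewrite -(tau_inv_col x i p) addrAC subrr add0r.
  rewrite mulr_sumr !mulr_suml; apply: eq_bigr => j _; rewrite mxE.
  have := amp_neq0 x i; have := amp_neq0 x p.
  have : eta i + eta j != 0 by rewrite gt_eqF// addr_gt0.
  by move=> ? ? ?; field; do ?[apply/andP; split].
under eq_fun do rewrite WE.
apply: cvg_sumr0 => i.
apply: (@norm_le_cvg0 _ _ _
  (fun x => (`|z i| * 2) * `|(amp x i)^-1 * (amp x p)^-1|)) => [x|].
  rewrite !normrM ler_wpM2r// ler_wpM2l//.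
  apply: le_trans (ler_normB _ _) _; rewrite -[leRHS]/(1 + 1) lerD//.
    by case: eqP; rewrite ?normr1 ?normr0.
  exact: tau_inv_le1.
apply: cvgM0; apply/norm_cvg0P.
by have := cvgM (cvgy_ampV i) (cvgy_ampV p); rewrite mulr0; apply.
Qed.

Lemma integral_sqr_V_red p (c : R) : 0 <= c ->
  (\int[lebesgue_measure]_x (c * V_red eta a p x ^+ 2)%:E
    = (2 * eta p * c)%:E)%E.
Proof.
move=> c0; under eq_integral do
  rewrite V_redE exprMn sqr_sqrtr ?mulr_ge0 ?ltW// mulrA.
have e0 : 0 <= c * (2 * eta p) by rewrite mulr_ge0// mulr_ge0// ltW.
(* Limits of the primitive at +oo and -oo: -W_pp rises from -1 to 0. *)
have -> : 2 * eta p * c = c * (2 * eta p) * - 0 - c * (2 * eta p) * - 1 by ring.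
apply: (@ge0_continuous_FTC2T _ _ (fun x => c * (2 * eta p) * - W x p p)).
- by move=> x; rewrite mulr_ge0// sqr_ge0.
- move=> x; apply: cvgM; first exact: cvg_cst.
  by rewrite expr2; apply: cvgM; exact: continuous_tau_vec.
- move=> x; have dW := is_derive_tau_inv x p.
  by apply: is_derive_eq; rewrite /GRing.scale/=; ring.
- by apply: cvgM; [exact: cvg_cst|apply: cvgN; exact: cvgNy_tau_inv].
- by apply: cvgM; [exact: cvg_cst|apply: cvgN; exact: cvgy_tau_inv].
Qed.

End Solitons.

Local Close Scope classical_set_scope.

(** * Sizes and covering property of the index blocks *)

Section Blocks.
Variables (N K : nat) (k : 'I_K -> nat).
Hypothesis sum_k : (\sum_(alpha < K) k alpha)%N = N.

(** Extends [block_start] to all m, in particular to m = K, where the value is N. *)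
Let start (m : nat) : nat := (\sum_(beta < K | beta < m) k beta)%N.

Let startS (alpha : 'I_K) : start alpha.+1 = (block_start k alpha + k alpha)%N.
Proof.
rewrite /start /block_start (bigD1 alpha)//= addnC; congr (_ + _)%N.
by apply: eq_bigl => beta; rewrite ltnS ltn_neqAle andbC.
Qed.

Lemma block_end_le alpha : (block_start k alpha + k alpha <= N)%N.
Proof.
rewrite -startS -sum_k /start big_mkcond/=; apply: leq_sum => beta _.
by case: ifP.
Qed.

(** By [block_end_le] the interval is not truncated by the bound N. *)
Lemma card_block alpha : #|block N k alpha| = k alpha.
Proof.
have le_N := block_end_le alpha.
rewrite -sum1_card /block; under eq_bigl do rewrite inE.
rewrite -(big_mkord (fun i => block_start k alpha <= i <
  block_start k alpha + k alpha)%N (fun=> 1%N)).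
rewrite -big_nat_widen//.
rewrite (eq_bigl (fun i => xpredT i && (block_start k alpha <= i)%N))//.
by rewrite -big_nat_widenl// sum_nat_const_nat muln1 addKn.
Qed.

(** The block is indexed by the predecessor of the least m with i < [start m]. *)
Lemma block_cover (i : 'I_N) : exists alpha, i \in block N k alpha.
Proof.
have startK : start K = N.
  by rewrite -sum_k; apply: eq_bigl => beta; rewrite ltn_ord.
have ex : exists m, (i < start m)%N by exists K; rewrite startK.
case: (ex_minnP ex) => -[|m]; first by rewrite /start big_pred0.
move=> im mmin.
have mi : (start m <= i)%N.
  by rewrite leqNgt; apply/negP => /mmin; rewrite ltnn.
have mK : (m < K)%N.
  rewrite ltnNge; apply/negP => Km.
  suff : start m = N by move=> h; move: mi; rewrite h leqNgt ltn_ord.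
  rewrite -startK; apply: eq_bigl => beta.
  by rewrite ltn_ord (leq_trans _ Km).
by exists (Ordinal mK); rewrite inE -startS mi.
Qed.
End Blocks.

(** * Masses of the components and the unit mass condition *)

Lemma eta_of_inj (R : realType) (K : nat) (mu : 'I_K -> R) :
  (forall alpha beta : 'I_K, (alpha < beta)%N -> mu alpha < mu beta) ->
  (forall alpha, mu alpha < 0) -> injective (eta_of mu).
Proof.
move=> mu_incr mu_neg p q /(congr1 (fun x => x ^+ 2)).
rewrite /eta_of !sqr_sqrtr// !ltr0_norm// => /oppr_inj mupq.
apply/val_inj; have [/mu_incr|/mu_incr|//] := ltngtP p q;
  by rewrite mupq ltxx.
Qed.

Theorem mainTheorem6 (R : realType) (N K : nat) (mu : 'I_K -> R)
    (k : 'I_K -> nat) (a : 'I_K -> R) (n : 'I_K -> 'I_N -> R)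
    (u : 'I_N -> R -> R)
    (hN : (2 <= N)%N)
    (hmu_incr : forall alpha beta : 'I_K, (alpha < beta)%N -> mu alpha < mu beta)
    (hmu_neg : forall alpha : 'I_K, mu alpha < 0)
    (hk : forall alpha : 'I_K, (1 <= k alpha)%N)
    (hsum : (\sum_(alpha < K) k alpha)%N = N)
    (hu : M_multi mu k u)
    (ha : forall alpha : 'I_K, a alpha != 0)
    (hn : unit_blocks k n)
    (hrep : is_U mu k a n u) :
  (forall (alpha : 'I_K) (i : 'I_N), i \in block N k alpha ->
     ((\int[lebesgue_measure]_x (u i x ^+ 2)%:E)
        = (n alpha i ^+ 2)%:E
          * \int[lebesgue_measure]_x (V_red (eta_of mu) a alpha x ^+ 2)%:E)%E
     /\
     ((n alpha i ^+ 2)%:E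
          * \int[lebesgue_measure]_x (V_red (eta_of mu) a alpha x ^+ 2)%:E
        = (2 * eta_of mu alpha * n alpha i ^+ 2)%:E)%E)
  /\
  ((forall i : 'I_N, (\int[lebesgue_measure]_x (u i x ^+ 2)%:E = 1)%E)
   <->
   (forall alpha : 'I_K,
      eta_of mu alpha = (k alpha)%:R / 2 /\
      forall i : 'I_N, i \in block N k alpha ->
        n alpha i ^+ 2 = 1 / (k alpha)%:R)).
Proof.
have eta_gt0 alpha : 0 < eta_of mu alpha.
  by rewrite sqrtr_gt0 normr_gt0 lt_eqF.
have eta_inj := eta_of_inj hmu_incr hmu_neg.
have intV alpha c := @integral_sqr_V_red _ _ _ a eta_gt0 eta_inj ha alpha c.
have intV1 alpha : (\int[lebesgue_measure]_x
    (V_red (eta_of mu) a alpha x ^+ 2)%:E = (2 * eta_of mu alpha)%:E)%E.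
  have := intV alpha 1 ler01; rewrite mulr1 => <-.
  by apply: eq_integral => x _; rewrite mul1r.
have intu alpha i : i \in block N k alpha -> (\int[lebesgue_measure]_x
    (u i x ^+ 2)%:E = (2 * eta_of mu alpha * n alpha i ^+ 2)%:E)%E.
  move=> ia; rewrite -intV ?sqr_ge0//; apply: eq_integral => x _.
  by rewrite (hrep _ _ ia) exprMn.
split=> [alpha i ia|].
  by rewrite (intu _ _ ia) intV1 -EFinM; split; congr EFin; ring.
split=> [u1 alpha|nE i].
  have etan i : i \in block N k alpha -> 2 * eta_of mu alpha * n alpha i ^+ 2 = 1.
    by move=> ia; have := u1 i; rewrite (intu _ _ ia) => -[].
  (* Summing [etan] over the block gives 2 eta on the left, as n is a unit vector, and the block
     size on the right. *)
  have eta2 : 2 * eta_of mu alpha = (k alpha)%:R.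
    have := congr1 ( *%R (2 * eta_of mu alpha)) (hn alpha).
    rewrite mulr1 => <-; rewrite mulr_sumr (eq_bigr (fun=> 1)) => [|i /etan//].
    by rewrite sumr_const (card_block hsum).
  split=> [|i /etan]; first by rewrite -eta2 mulrC mulKf.
  have k0 : (k alpha)%:R != 0 :> R by rewrite pnatr_eq0 -lt0n.
  by rewrite eta2 => h; apply: (mulfI k0); rewrite h mulrC divfK.
(* Conversely, each i lies in some block, where the mass is k (1 / k) = 1. *)
have [alpha ia] := block_cover hsum i.
have [etaE /(_ _ ia) nE'] := nE alpha.
have k0 : (k alpha)%:R != 0 :> R by rewrite pnatr_eq0 -lt0n.
rewrite (intu _ _ ia) etaE nE'; congr EFin.
by field.
Qed.
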